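(* The Minkowski measure $?'$ is an eigenfunction, with eigenvalue one, of the transfer operator $\mathcal{L}_A$ (push-forward) of the map $A$: $$\mathcal{L}_A\,?'=\,?' ,$$ i.e. the Minkowski measure is invariant under $A$: writing $\mu$ for the Minkowski measure, $\mu(A^{-1}(B))=\mu(B)$ for every Borel set $B\subseteq[0,1]$.
   Context: The Minkowski Question Mark function $?:[0,1]\to[0,1]$ is defined as follows. For rational $x\in[0,1]$ with finite continued fraction $x=[0;a_1,a_2,\dots,a_N]$ (positive integers $a_k$), $?(x)=2\sum_{k=1}^{N}(-1)^{k+1}2^{-(a_1+a_2+\cdots+a_k)}$ (with $?(0)=0$, $?(1)=1$). For irrational $x=[0;a_1,a_2,\dots]$ one takes the limit $N\to\infty$ of this sum. The function is continuous and strictly increasing. The Minkowski measure, written $?'$ or $\mu$, is the Lebesgue-Stieltjes measure on $[0,1]$ assigning mass $?(b)-?(a)$ to the interval from $a$ to $b$. The map $A:[0,1]\to[0,1]$ is $A(y)=\frac{y}{1-y}$ for $0\le y\le\frac12$ and $A(y)=\frac{2y-1}{y}$ for $\frac12\le y\le1$ (the value at the single point $y=\frac12$, where the branches disagree, is immaterial). Its transfer operator acts on densities $f$ on $[0,1]$ by $$[\mathcal{L}_Af](y)=\frac{1}{(1+y)^2}f\!\left(\frac{y}{1+y}\right)+\frac{1}{(2-y)^2}f\!\left(\frac{1}{2-y}\right),$$ which on measures is the push-forward $\mu\mapsto\mu\circ A^{-1}$. *)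

(* Defs.v *)
From HB Require Import structures.
From mathcomp Require Import all_boot all_order all_algebra.
From mathcomp Require Import all_classical all_reals all_analysis.
From mathcomp Require Import ring lra.

Set Implicit Arguments.
Unset Strict Implicit.
Unset Printing Implicit Defensive.

Import Order.TTheory GRing.Theory Num.Theory.
Import numFieldNormedType.Exports.

Local Open Scope classical_set_scope.
Local Open Scope ring_scope.

Section question_mark.
Context {R : realType}.
Implicit Types x y t : R.

(* The remainder of the continued fraction algorithm. Since 0^-1 = 0, it fixes
   0, so an expansion that terminates is followed by zero remainders. *)
Definition gauss_map x : R := x^-1 - (Num.truncn x^-1)%:R.

Definition cf_remainder x (k : nat) : R := iter k gauss_map x.

(* Indices start from 0: cf_digit x k is the partial quotient a_(k+1) of
   x = [0; a_1, a_2, ...]. *)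
Definition cf_digit x (k : nat) : nat := Num.truncn (cf_remainder x k)^-1.

(* The term of index k + 1, that is (-1)^(k+2) 2^-(a_1 + ... + a_(k+1)) with
   (-1)^(k+2) = (-1)^k; it is zero when the expansion of x has at most k
   partial quotients. *)
Definition question_mark_term x (k : nat) : R :=
  if cf_remainder x k == 0 then 0
  else (-1) ^+ k * 2 ^- (\sum_(i < k.+1) cf_digit x i).

(* The series is eventually zero when x is rational. Only the values on [0, 1]
   are meaningful. *)
Definition question_mark x : R :=
  2 * limn (series (question_mark_term x)).

Definition question_mark_psum (n : nat) x : R :=
  2 * series (question_mark_term x) n.

Lemma gauss_map0 : gauss_map 0 = 0.
Proof. by rewrite /gauss_map invr0 truncn0 subrr. Qed.

Lemma gauss_map_itv x : 0 <= x -> 0 <= gauss_map x < 1.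
Proof.
move=> x0; have := truncn_itv (_ : 0 <= x^-1); rewrite invr_ge0 => /(_ x0).
by rewrite /gauss_map -natr1 => /andP[? ?]; apply/andP; split; lra.
Qed.

Lemma cf_remainder0 k : cf_remainder 0 k = 0.
Proof. by elim: k => //= k; rewrite /cf_remainder /= => ->; exact: gauss_map0. Qed.

Lemma cf_remainder_itv x k : 0 <= x <= 1 -> 0 <= cf_remainder x k <= 1.
Proof.
move=> x01; elim: k => // k /andP[k0 _].
by have /andP[-> /ltW] := gauss_map_itv k0.
Qed.

Lemma question_mark_term0 k : question_mark_term 0 k = 0.
Proof. by rewrite /question_mark_term cf_remainder0 eqxx. Qed.

Lemma question_mark_termS x k : x != 0 -> question_mark_term x k.+1 =
  - (2 ^- (cf_digit x 0) * question_mark_term (gauss_map x) k).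
Proof.
move=> x0; rewrite /question_mark_term /cf_remainder iterSr.
case: ifP => _; first by rewrite mulr0 oppr0.
rewrite big_ord_recl exprD invfM exprS.
under eq_bigr do rewrite /cf_digit /cf_remainder lift0 iterSr.
by rewrite -/(cf_remainder x 0) -/(cf_digit x 0); ring.
Qed.

Lemma cf_digit0_gt0 x : 0 < x <= 1 -> (0 < cf_digit x 0)%N.
Proof.
move=> /andP[x0 x1]; rewrite /cf_digit /cf_remainder /= truncn_gt_nat.
by rewrite -[1%:R]invr1 lef_pV2 ?posrE.
Qed.

Lemma question_mark_term_le x k : 0 <= x <= 1 ->
  `|question_mark_term x k| <= 2 ^- k.+1.
Proof.
move=> x01; elim: k x x01 => [|k IH] x x01.
  rewrite /question_mark_term; case: ifPn => [_|x0].
    by rewrite normr0 invr_ge0 exprn_ge0.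
  rewrite big_ord1 expr0 mul1r ger0_norm ?invr_ge0 ?exprn_ge0//.
  rewrite lef_pV2 ?posrE ?exprn_gt0// ler_eXn2l// ?cf_digit0_gt0//; last by lra.
  by move: x0 x01; rewrite /cf_remainder /= lt0r => -> /andP[-> ->].
have [->|x0] := eqVneq x 0.
  by rewrite question_mark_term0 normr0 invr_ge0 exprn_ge0.
rewrite question_mark_termS// normrN normrM exprS invfM.
apply: ler_pM => //; last first.
  by apply: IH; move: x01 => /andP[/gauss_map_itv/andP[-> /ltW]].
rewrite ger0_norm ?invr_ge0 ?exprn_ge0//.
rewrite lef_pV2 ?posrE ?exprn_gt0// -{1}(expr1 2) ler_eXn2l//; last by lra.
by rewrite cf_digit0_gt0// lt0r x0.
Qed.

Lemma is_cvg_question_mark x : 0 <= x <= 1 ->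
  cvgn (series (question_mark_term x)).
Proof.
move=> x01; apply: normed_cvg.
apply: (@series_le_cvg _ _ (geometric 2^-1 2^-1)).
- by move=> n; rewrite /= normr_ge0.
- by move=> n; rewrite /geometric /= mulr_ge0// ?exprn_ge0 ?invr_ge0.
- by move=> n; rewrite /geometric /= -exprS exprVn question_mark_term_le.
- by apply: is_cvg_geometric_series; rewrite ger0_norm//; lra.
Qed.

Lemma cvg_question_mark_psum x : 0 <= x <= 1 ->
  question_mark_psum n x @[n --> \oo] --> question_mark x.
Proof. by move=> x01; apply: cvgMl_tmp; exact: is_cvg_question_mark. Qed.

Lemma question_mark_psumS n x : x != 0 -> question_mark_psum n.+1 x =
  2 ^- (cf_digit x 0) * (2 - question_mark_psum n (gauss_map x)).
Proof.
move=> x0; rewrite /question_mark_psum /series /= !big_mkord big_ord_recl.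
under eq_bigr do rewrite lift0 question_mark_termS//.
rewrite sumrN -mulr_sumr {1}/question_mark_term /cf_remainder /= (negbTE x0).
by rewrite big_ord1 expr0; ring.
Qed.

Lemma question_mark_psum0 n : question_mark_psum n 0 = 0.
Proof.
rewrite /question_mark_psum /series /= big1 ?mulr0// => i _.
exact: question_mark_term0.
Qed.

Lemma question_mark0 : question_mark 0 = 0.
Proof.
have : question_mark_psum n 0 @[n --> \oo] --> question_mark 0.
  by apply: cvg_question_mark_psum; rewrite lexx ler01.
under eq_fun do rewrite question_mark_psum0.
by move=> /cvg_lim <-//; rewrite lim_cst.
Qed.

Lemma question_markS x : 0 < x <= 1 -> question_mark x =
  2 ^- (cf_digit x 0) * (2 - question_mark (gauss_map x)).
Proof.
move=> /andP[x0 x1].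
have /cvg_question_mark_psum cx : 0 <= x <= 1 by rewrite ltW.
have /cvg_question_mark_psum cg : 0 <= gauss_map x <= 1.
  by have /andP[-> /ltW] := gauss_map_itv (ltW x0).
rewrite -cvg_shiftS in cx; move: cx.
under eq_fun do rewrite question_mark_psumS ?gt_eqF//.
move=> /cvg_lim <-//; apply/cvg_lim => //.
by apply: cvgMl_tmp; apply: cvgB => //; exact: cvg_cst.
Qed.

Lemma question_mark_psum_itv n x : 0 <= x <= 1 ->
  0 <= question_mark_psum n x <= 1.
Proof.
elim: n x => [|n IH] x /andP[x0 x1].
  by rewrite /question_mark_psum /series /= big_geq// mulr0 lexx ler01.
have [->|xn0] := eqVneq x 0; first by rewrite question_mark_psum0 lexx ler01.
rewrite question_mark_psumS//.
have /IH/andP[g0 g1] : 0 <= gauss_map x <= 1.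
  by have /andP[-> /ltW] := gauss_map_itv x0.
have d0 : (0 < cf_digit x 0)%N by rewrite cf_digit0_gt0// lt0r xn0 x0.
have d2 : 2 ^- cf_digit x 0 <= 2^-1 :> R.
  by rewrite lef_pV2 ?posrE ?exprn_gt0// -{1}(expr1 2) ler_eXn2l//; lra.
have dp : 0 < 2 ^- cf_digit x 0 :> R by rewrite invr_gt0 exprn_gt0.
by apply/andP; split; nra.
Qed.

Lemma question_mark_psum_le n x y : 0 <= x -> x <= y -> y <= 1 ->
  question_mark_psum n x <= question_mark_psum n y.
Proof.
elim: n x y => [|n IH] x y x0 xy y1.
  by rewrite /question_mark_psum /series /= !big_geq.
have [->|xn0] := eqVneq x 0.
  rewrite question_mark_psum0.
  by have /andP[] : 0 <= question_mark_psum n.+1 y <= 1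
    by apply: question_mark_psum_itv; rewrite (le_trans x0 xy) y1.
have xp : 0 < x by rewrite lt0r xn0 x0.
have yp : 0 < y by rewrite (lt_le_trans xp).
have y0 := ltW yp.
rewrite !question_mark_psumS ?gt_eqF//.
have gx := gauss_map_itv x0; have gy := gauss_map_itv y0.
have /(question_mark_psum_itv n)/andP[gx0 gx1] : 0 <= gauss_map x <= 1.
  by move: gx => /andP[-> /ltW].
have /(question_mark_psum_itv n)/andP[gy0 gy1] : 0 <= gauss_map y <= 1.
  by move: gy => /andP[-> /ltW].
have ixy : y^-1 <= x^-1 by rewrite lef_pV2 ?posrE.
have : (cf_digit y 0 <= cf_digit x 0)%N by apply: le_truncn.
rewrite leq_eqVlt => /predU1P[e|lt_d].
  rewrite e ler_pM2l ?invr_gt0 ?exprn_gt0// lerD2l lerN2.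
  apply: IH; first by case/andP: gy.
    rewrite /gauss_map -[Num.truncn x^-1]/(cf_digit x 0) -e.
    by rewrite -[Num.truncn y^-1]/(cf_digit y 0) lerD2r.
  by case/andP: gx => _ /ltW.
apply: (@le_trans _ _ (2 ^- cf_digit y 0)).
  apply: (@le_trans _ _ (2 ^- cf_digit x 0 * 2)).
    by rewrite ler_pM2l ?invr_gt0 ?exprn_gt0// gerBl.
  apply: (@le_trans _ _ (2 ^- (cf_digit y 0).+1 * 2)).
    rewrite ler_pM2r// lef_pV2 ?posrE ?exprn_gt0// ler_eXn2l//; lra.
  by rewrite exprS invfM mulrAC mulVf ?mul1r.
by rewrite ler_peMr ?invr_ge0 ?exprn_ge0//; lra.
Qed.

Lemma question_mark_itv x : 0 <= x <= 1 -> 0 <= question_mark x <= 1.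
Proof.
move=> x01; have cx := cvg_question_mark_psum x01.
apply/andP; split.
  rewrite -(cvg_lim _ cx)//; apply: limr_ge; first by apply: cvgP cx.
  by apply: nearW => n; have /andP[] := question_mark_psum_itv n x01.
rewrite -(cvg_lim _ cx)//; apply: limr_le; first by apply: cvgP cx.
by apply: nearW => n; have /andP[] := question_mark_psum_itv n x01.
Qed.

Lemma question_mark_le x y : 0 <= x -> x <= y -> y <= 1 ->
  question_mark x <= question_mark y.
Proof.
move=> x0 xy y1.
have cx : question_mark_psum n x @[n --> \oo] --> question_mark x.
  by apply: cvg_question_mark_psum; rewrite x0 (le_trans xy).
have cy : question_mark_psum n y @[n --> \oo] --> question_mark y.
  by apply: cvg_question_mark_psum; rewrite y1 (le_trans x0).
rewrite -(cvg_lim _ cx)// -(cvg_lim _ cy)//.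
apply: ler_lim; [by apply: cvgP cx|by apply: cvgP cy|].
by apply: nearW => n; exact: question_mark_psum_le.
Qed.

Lemma question_mark_natV (a : nat) : (0 < a)%N ->
  question_mark (a%:R^-1) = 2 * 2 ^- a.
Proof.
move=> a0; have aR : 0 < a%:R :> R by rewrite ltr0n.
rewrite question_markS; last first.
  by rewrite invr_gt0 aR /= -[leRHS]invr1 lef_pV2 ?posrE// ler1n.
rewrite /cf_digit /cf_remainder /= invrK.
rewrite /gauss_map invrK natrK subrr question_mark0 subr0 mulrC.
by [].
Qed.

Lemma question_mark1 : question_mark 1 = 1.
Proof. by rewrite -[1 in LHS]invr1 (question_mark_natV (a := 1))// expr1 mulfV. Qed.

(* At t = 1 the left-hand side has a partial quotient a + 1 instead of a. *)
Lemma question_mark_branch (a : nat) t : (0 < a)%N -> 0 <= t <= 1 ->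
  question_mark ((a%:R + t)^-1) = 2 ^- a * (2 - question_mark t).
Proof.
move=> a0 /andP[t0]; rewrite le_eqVlt => /predU1P[->|t1].
  rewrite question_mark1 natr1 question_mark_natV// exprS invfM.
  by rewrite mulrA mulfV// mul1r addrK mulr1.
have aR : 1 <= a%:R :> R by rewrite ler1n.
have d : Num.truncn (a%:R + t) = a by apply: truncn_def; rewrite -natr1; lra.
rewrite question_markS; last first.
  rewrite invr_gt0 -[leRHS]invr1 lef_pV2 ?posrE//; last by lra.
  by apply/andP; split; lra.
rewrite /cf_digit /cf_remainder /= /gauss_map !invrK d.
by rewrite [a%:R + t]addrC addrK.
Qed.

(* The finite continued fraction [0; a_1, ..., a_N]; no constraint is put on
   a_N, so that both expansions of a rational number are covered. *)
Definition finite_cf (s : seq nat) : R :=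
  foldr (fun (a : nat) (t : R) => (a%:R + t)^-1) 0 s.

Lemma finite_cf_itv s : all (leq 1) s -> 0 <= finite_cf s <= 1.
Proof.
elim: s => [_|a s IH] /=; first by rewrite lexx ler01.
case/andP => a0 /IH/andP[s0 s1].
have aR : 1 <= a%:R :> R by rewrite ler1n.
rewrite invr_ge0 invf_le1; last by lra.
by apply/andP; split; lra.
Qed.

Lemma question_mark_finite_cf s : all (leq 1) s ->
  question_mark (finite_cf s) =
  2 * \sum_(k < size s) (-1) ^+ k * 2 ^- (\sum_(i < k.+1) nth 0%N s i).
Proof.
elim: s => [_|a s IH] /=; first by rewrite question_mark0 big_ord0 mulr0.
case/andP => a0 s0; rewrite question_mark_branch ?finite_cf_itv// IH//.
rewrite big_ord_recl/= big_ord1/= expr0.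
under [in RHS]eq_bigr => k _.
  rewrite /bump leq0n add1n big_ord_recl/= exprD invfM exprS.
  under eq_bigr do rewrite add0n.
  rewrite (_ : _ * _ = - (2 ^- a) *
    ((-1) ^+ k * 2 ^- (\sum_(i < k.+1) nth 0%N s i))); last by ring.
  over.
by rewrite -mulr_sumr; ring.
Qed.

Let right_branch x : 0 < x < 1 ->
  exists a t, [/\ (0 < a)%N, 0 < t <= 1 & x = (a%:R + t)^-1].
Proof.
case/andP=> x0 x1; have xV : 1 < x^-1 by rewrite -[ltLHS]invr1 ltf_pV2 ?posrE.
have /truncn_itv : 0 <= x^-1 by lra.
set m := Num.truncn _; rewrite -natr1 => /andP[mx xm].
have m0 : (0 < m)%N by rewrite truncn_gt_nat; lra.
have [e|ne] := eqVneq x^-1 m%:R.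
  have m1 : (1 < m)%N by rewrite -(ltr_nat R) -e.
  exists m.-1, 1; split; [by rewrite -ltnS prednK|by rewrite ltr01 lexx|].
  by rewrite natr1 prednK// -e invrK.
exists m, (x^-1 - m%:R); split => //; last by rewrite addrC subrK invrK.
by rewrite subr_gt0 lt_neqAle eq_sym ne mx /=; lra.
Qed.

Let left_branch x : 0 < x <= 1 ->
  exists a t, [/\ (0 < a)%N, 0 <= t < 1 & x = (a%:R + t)^-1].
Proof.
move=> x01; have /andP[x0 x1] := x01.
exists (cf_digit x 0), (gauss_map x); split.
- exact: cf_digit0_gt0.
- exact/gauss_map_itv/ltW.
- by rewrite /gauss_map /cf_digit /cf_remainder /= addrC subrK invrK.
Qed.

Let question_mark_continuous_aux n :
  (forall x, 0 <= x < 1 -> exists2 z, x < z <= 1 &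
     question_mark z <= question_mark x + 2 ^- n) /\
  (forall x, 0 < x <= 1 -> exists2 z, 0 <= z < x &
     question_mark x <= question_mark z + 2 ^- n).
Proof.
have half a : (0 < a)%N -> 2 ^- a <= 2^-1 :> R.
  by move=> a0; rewrite lef_pV2 ?posrE ?exprn_gt0// -{1}(expr1 2) ler_eXn2l//; lra.
elim: n => [|n [IHr IHl]].
  split => x /andP[x0 x1].
    exists 1; first by rewrite x1 lexx.
    have /andP[? _] : 0 <= question_mark x <= 1.
      by apply: question_mark_itv; rewrite x0 ltW.
    by rewrite question_mark1 expr0 invr1; lra.
  exists 0; first by rewrite lexx.
  have /andP[_ ?] : 0 <= question_mark x <= 1.
    by apply: question_mark_itv; rewrite x1 ltW.
  by rewrite question_mark0 expr0 invr1; lra.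
have n0 : 0 < 2 ^- n :> R by rewrite invr_gt0 exprn_gt0.
split => x x01.
  have [->|xn0] := eqVneq x 0.
    exists n.+2%:R^-1.
      rewrite invr_gt0 ltr0n /= -[leRHS]invr1 lef_pV2 ?posrE ?ltr0n//.
      by rewrite ler1n.
    by rewrite question_mark_natV// question_mark0 add0r exprS invfM mulrA mulfV// mul1r.
  have [|a [t [a0 t01 xE]]] := right_branch (x := x).
    by move: x01 => /andP[x0 ->]; rewrite lt0r xn0 x0.
  have aR : 1 <= a%:R :> R by rewrite ler1n.
  have /andP[t0 t1] := t01.
  have [z /andP[z0 zt] qz] := IHl _ t01.
  exists (a%:R + z)^-1.
    rewrite xE ltf_pV2 ?posrE; [|lra|lra].
    rewrite -[leRHS]invr1 lef_pV2 ?posrE//; last by lra.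
    by apply/andP; split; lra.
  rewrite xE !question_mark_branch//; [|by apply/andP; split; lra..].
  have := half _ a0; have : 0 < 2 ^- a :> R by rewrite invr_gt0 exprn_gt0.
  rewrite exprS invfM => ? ?.
  have : question_mark z <= question_mark t by apply: question_mark_le => //; lra.
  by nra.
have [a [t [a0 t01 xE]]] := left_branch x01.
have aR : 1 <= a%:R :> R by rewrite ler1n.
have /andP[t0 t1] := t01.
have [z /andP[tz z1] qz] := IHr _ t01.
exists (a%:R + z)^-1.
  rewrite xE ltf_pV2 ?posrE; [|lra|lra].
  by rewrite invr_ge0; apply/andP; split; lra.
rewrite xE !question_mark_branch//; [|by apply/andP; split; lra..].
have := half _ a0; have : 0 < 2 ^- a :> R by rewrite invr_gt0 exprn_gt0.
rewrite exprS invfM => ? ?.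
have : question_mark t <= question_mark z by apply: question_mark_le => //; lra.
by nra.
Qed.

(* The extension of the question mark function to the real line by 0 on the
   left and by 1 on the right. *)
Definition question_mark_cdf x : R := question_mark (Num.max 0 (Num.min x 1)).

Lemma question_mark_cdfE x : 0 <= x <= 1 ->
  question_mark_cdf x = question_mark x.
Proof.
by move=> /andP[x0 x1]; rewrite /question_mark_cdf min_l// max_r.
Qed.

Let question_mark_cdf_nd : nondecreasing question_mark_cdf.
Proof.
move=> x y xy; apply: question_mark_le.
- by rewrite le_max lexx.
- rewrite ge_max le_max lexx /= le_max; apply/orP; right.
  by rewrite le_min !ge_min xy lexx orbT.
- by rewrite ge_max ler01 ge_min lexx orbT.
Qed.

Let question_mark_cdf_rc : right_continuous question_mark_cdf.
Proof.
move=> x; apply/cvgrPdist_le => /= e e0.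
have [n ne] : exists n, 2 ^- n <= e.
  have [n _ /(_ n (leqnn n))] : \forall n \near \oo, `|0 - (2^-1) ^+ n| <= e.
    have /cvgrPdist_le/(_ e e0) // : (2^-1 ^+ n : R) @[n --> \oo] --> (0 : R).
    by apply: cvg_expr; rewrite ger0_norm//; lra.
  rewrite /= sub0r normrN ger0_norm ?exprn_ge0// exprVn => ?; by exists n.
have [z xz qz] : exists2 z, x < z &
    question_mark_cdf z <= question_mark_cdf x + 2 ^- n.
  have n0 : 0 <= 2 ^- n :> R by rewrite invr_ge0 exprn_ge0.
  have [xlt0|x0] := ltP x 0.
    exists 0 => //; rewrite /question_mark_cdf [Num.min x 1]min_l; last by lra.
    by rewrite [Num.min 0 1]min_l// maxxx [Num.max 0 x](max_l (ltW xlt0)) lerDl.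
  have [x1|x1] := ltP x 1.
    have [|z /andP[xz z1] qz] := (question_mark_continuous_aux n).1 x.
      by rewrite x0.
    exists z => //; rewrite !question_mark_cdfE ?x0 ?(ltW x1)//.
    by rewrite z1 (le_trans x0 (ltW xz)).
  exists (x + 1); first by lra.
  rewrite /question_mark_cdf min_r; last by lra.
  by rewrite [Num.min x 1]min_r// lerDl.
near=> y.
have xy : x <= y by near: y; exact: nbhs_right_ge.
have yz : y <= z by near: y; exact: nbhs_right_le.
rewrite distrC ger0_norm ?subr_ge0 ?question_mark_cdf_nd//.
have := question_mark_cdf_nd yz.
by lra.
Unshelve. all: by end_near. Qed.

HB.instance Definition _ := isCumulative.Build R _ R question_mark_cdf
  question_mark_cdf_nd question_mark_cdf_rc.

(* A measure on the Borel sets of the real line; it vanishes outside [0, 1]. *)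
Definition minkowski_measure :=
  lebesgue_stieltjes_measure question_mark_cdf.

(* The value at 1/2 is the one of the left branch; A is only meant on [0, 1]. *)
Definition map_A y : R :=
  if y <= 2^-1 then y / (1 - y) else (2 * y - 1) / y.

(* The transfer operator of A on measures is the push-forward by
   A : [0, 1] -> [0, 1]. *)
Definition transfer_A (m : set (measurableTypeR R) -> \bar R) :
    set (measurableTypeR R) -> \bar R :=
  fun B => m (`[0, 1] `&` map_A @^-1` B).

End question_mark.

(* Main.v *)
(* The inverse branches of A are y |-> y / (1 + y) and y |-> 1 / (2 - y), and
   the question mark function q conjugates them to y |-> y / 2 and
   y |-> (1 + y) / 2: the first one increments the first partial quotient, the
   second one is its conjugate by the symmetry q (1 - x) = 1 - q x. Hence the
   two pieces of the preimage of an interval each carry half of its mass. Since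
   open-closed intervals determine a Lebesgue-Stieltjes measure, this suffices.
   The point 0, which A fixes and which has mass zero, is removed so that the
   preimage of ]c, d] is again a union of open-closed intervals. *)

Require Import Defs.
From HB Require Import structures.
From mathcomp Require Import all_boot all_order all_algebra.
From mathcomp Require Import all_classical all_reals all_analysis.
From mathcomp Require Import measurable_realfun ring lra.

Import Order.TTheory GRing.Theory Num.Theory.
Import numFieldNormedType.Exports.

Local Open Scope classical_set_scope.
Local Open Scope ring_scope.

Set Implicit Arguments.
Unset Strict Implicit.
Unset Printing Implicit Defensive.

Section minkowski_invariance.
Context {R : realType}.
Implicit Types x y c d : R.

Lemma question_mark_inv1D x : 0 <= x <= 1 ->
  question_mark (1 + x)^-1 = 1 - question_mark x / 2.
Proof. by move=> x01; rewrite (question_mark_branch (a := 1))// expr1; lra. Qed.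

(* For y = [0; a_1, a_2, ...] the point y / (1 + y) is [0; a_1 + 1, a_2, ...]. *)
Lemma question_mark_div1D y : 0 <= y <= 1 ->
  question_mark (y / (1 + y)) = question_mark y / 2.
Proof.
move=> /andP[y0 y1]; have [->|yn0] := eqVneq y 0.
  by rewrite !mul0r question_mark0 mul0r.
have yp : 0 < y by rewrite lt0r yn0.
have /andP[g0 g1] := gauss_map_itv y0.
have d0 : (0 < cf_digit y 0)%N by rewrite cf_digit0_gt0// yp.
have dR : 1 <= (cf_digit y 0)%:R :> R by rewrite ler1n.
have yE : y = ((cf_digit y 0)%:R + gauss_map y)^-1.
  by rewrite /gauss_map /cf_digit /cf_remainder /= addrC subrK invrK.
have -> : y / (1 + y) = ((cf_digit y 0).+1%:R + gauss_map y)^-1.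
  rewrite [in LHS]yE -natr1; field.
  by apply/andP; split; apply/negP => /eqP; lra.
rewrite question_mark_branch ?g0 ?(ltW g1)//.
rewrite [in RHS]yE question_mark_branch ?g0 ?(ltW g1)//.
by rewrite exprS invfM; ring.
Qed.

(** For x >= 1/2 put t = 1/x - 1, which lies in [0, 1]: then x = 1 / (1 + t) and 1 - x = t / (1 +
    t), so the two branch formulas give values with sum 1. The case x < 1/2 follows by exchanging x
    and 1 - x. *)
Lemma question_mark_onem x : 0 <= x <= 1 ->
  question_mark (1 - x) = 1 - question_mark x.
Proof.
have half y : 2^-1 <= y <= 1 -> question_mark (1 - y) = 1 - question_mark y.
  move=> /andP[y0 y1].
  have yp : 0 < y by lra.
  have t01 : 0 <= y^-1 - 1 <= 1.
    have : y * y^-1 = 1 by rewrite mulfV ?gt_eqF.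
    by move=> ?; apply/andP; split; nra.
  have := question_mark_div1D t01; have := question_mark_inv1D t01.
  rewrite [1 + (_ - _)]addrC subrK invrK mulrBl mulVf ?gt_eqF// mul1r => -> ->.
  by ring.
move=> /andP[x0 x1]; have [x2|x2] := leP 2^-1 x; first by rewrite half ?x2.
have -> : question_mark x = question_mark (1 - (1 - x)) by rewrite subKr.
by rewrite [in RHS]half ?subKr//; apply/andP; split; lra.
Qed.

Lemma question_mark_inv2B y : 0 <= y <= 1 ->
  question_mark (2 - y)^-1 = (1 + question_mark y) / 2.
Proof.
move=> /andP[y0 y1].
have -> : 2 - y = 1 + (1 - y) by ring.
rewrite question_mark_inv1D ?question_mark_onem ?y0 ?y1//; first by field.
by apply/andP; split; lra.
Qed.

Lemma minkowski_measure_itv c d : c <= d ->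
  minkowski_measure `]c, d] = (question_mark_cdf d - question_mark_cdf c)%:E.
Proof.
move=> cd; rewrite /minkowski_measure /lebesgue_stieltjes_measure.
rewrite /measure_extension/= measurable_mu_extE/=; last exact: is_ocitv.
by rewrite wlength_itv_bnd.
Qed.

Lemma minkowski_measure_itv01 c d : 0 <= c -> c <= d -> d <= 1 ->
  minkowski_measure `]c, d] = (question_mark d - question_mark c)%:E.
Proof.
move=> c0 cd d1; rewrite minkowski_measure_itv// !question_mark_cdfE//.
  by rewrite c0 (le_trans cd).
by rewrite d1 (le_trans c0).
Qed.

(** The point lies in ]-1, 0], on which [question_mark_cdf] is constantly 0. *)
Lemma minkowski_measure_set1_0 : minkowski_measure [set (0 : R)] = 0%E.
Proof.
apply: (@subset_measure0 _ _ _ (lebesgue_stieltjes_measure question_mark_cdf)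
  _ (`]-1, 0]%classic : set R)) => //.
- by move=> _ ->; rewrite /= in_itv /= lexx ltrN10.
- apply: (etrans (minkowski_measure_itv (lerN10 R))).
  rewrite question_mark_cdfE ?lexx ?ler01// question_mark0 /question_mark_cdf.
  by rewrite min_l ?lerN1// ?max_l ?lerN10// ?question_mark0 ?subrr//; lra.
Qed.

(** Inversion is continuous only away from 0, so the closed singleton of 0 is treated apart from its
    open complement. *)
Lemma measurable_inv : measurable_fun [set: measurableTypeR R] (@GRing.inv R).
Proof.
have -> : [set: measurableTypeR R] = [set 0] `|` ~` [set 0].
  by rewrite setUv.
have m0 : measurable [set (0 : R)] by exact: measurable_set1.
apply/measurable_funU => //; first exact: measurableC.
split; first exact: measurable_fun_set1.
apply: open_continuous_measurable_fun.
  by rewrite openC; exact: (@closed_eq _ 0).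
by move=> x; rewrite inE /= => /eqP x0; exact: inv_continuous.
Qed.

Lemma measurable_map_A :
  measurable_fun [set: measurableTypeR R]
    (map_A : measurableTypeR R -> measurableTypeR R).
Proof.
apply: measurable_fun_ifT => /=.
- exact: measurable_fun_ler.
- apply: measurable_funM => //.
  apply: (measurableT_comp measurable_inv).
  exact: measurable_funB.
- apply: measurable_funM; last exact: measurable_inv.
  by apply: measurable_funB => //; exact: measurable_funM.
Qed.

(** This lets a target interval be clipped to [0, 1] without changing its preimage in ]0, 1]. *)
Lemma map_A_itv x : 0 < x <= 1 -> 0 < map_A x <= 1.
Proof.
move=> /andP[x0 x1]; rewrite /map_A; case: (leP x 2^-1) => x2.
  by rewrite divr_gt0 ?ler_pdivrMr; lra.
by rewrite divr_gt0 ?ler_pdivrMr; lra.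
Qed.

(** Both inverse branches are increasing, so each sends ]c, d] to an open-closed interval. The
    second one starts at 1 / (2 - c) >= 1/2 and is open there, so it misses 1/2, where [map_A] takes
    its left branch. *)
Lemma preimage_map_A_itv c d : 0 <= c -> c <= d -> d <= 1 ->
  map_A @^-1` `]c, d] `&` `]0, 1] =
  `]c / (1 + c), d / (1 + d)] `|` `](2 - c)^-1, (2 - d)^-1].
Proof.
move=> c0 cd d1.
have c1 : 0 < 1 + c by lra.
have d1' : 0 < 1 + d by lra.
have c2 : 0 < 2 - c by lra.
have d2 : 0 < 2 - d by lra.
have cV : c / (1 + c) * (1 + c) = c by rewrite divfK ?gt_eqF.
have dV : d / (1 + d) * (1 + d) = d by rewrite divfK ?gt_eqF.
apply/seteqP; split => [x|x].
  rewrite /= !in_itv/= /map_A => -[+ /andP[x0 x1]].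
  case: (leP x 2^-1) => x2 /andP[cx xd].
    left; rewrite ltr_pdivrMr// ler_pdivlMr//.
    have x1p : 0 < 1 - x by lra.
    move: cx xd; rewrite ltr_pdivlMr// ler_pdivrMr// => ? ?.
    by apply/andP; split; lra.
  right; rewrite invf_plt ?posrE// -[(2 - d)^-1]div1r ler_pdivlMr//.
  move: cx xd; rewrite ltr_pdivlMr// ler_pdivrMr// => cx xd.
  rewrite -[x^-1]div1r ltr_pdivrMr//.
  by apply/andP; split; lra.
rewrite /= !in_itv/= /map_A => -[|] /andP[].
  rewrite ltr_pdivrMr// ler_pdivlMr// => cx xd.
  have x0 : 0 < x by nra.
  have x2 : x <= 2^-1 by nra.
  have x1p : 0 < 1 - x by lra.
  rewrite x2 ltr_pdivlMr// ler_pdivrMr//.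
  by split; apply/andP; split; lra.
rewrite -[(2 - d)^-1]div1r ler_pdivlMr// -[(2 - c)^-1]div1r ltr_pdivrMr//.
move=> cx xd.
have x2 : 2^-1 < x by nra.
have x0 : 0 < x by lra.
rewrite leNgt x2 /= ltr_pdivlMr// ler_pdivrMr//.
by split; apply/andP; split; nra.
Qed.

Lemma minkowski_measure_preimage_itv c d : 0 <= c -> c <= d -> d <= 1 ->
  minkowski_measure (map_A @^-1` `]c, d] `&` `]0, 1]) =
  minkowski_measure (`]c, d] : set R).
Proof.
move=> c0 cd d1; rewrite preimage_map_A_itv//.
have c01 : 0 <= c <= 1 by rewrite c0 (le_trans cd).
have d01 : 0 <= d <= 1 by rewrite d1 (le_trans c0).
have c1 : 0 < 1 + c by lra.
have d1' : 0 < 1 + d by lra.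
have c2 : 0 < 2 - c by lra.
have d2 : 0 < 2 - d by lra.
have cV : c / (1 + c) * (1 + c) = c by rewrite divfK ?gt_eqF.
have dV : d / (1 + d) * (1 + d) = d by rewrite divfK ?gt_eqF.
(* The point 1/2 separates the two pieces; their disjointness rests on [dh] and [ch]. *)
have dh : d / (1 + d) <= 2^-1 by rewrite ler_pdivrMr//; lra.
have ch : 2^-1 <= (2 - c)^-1 by rewrite lef_pV2 ?posrE//; lra.
have cdl : c / (1 + c) <= d / (1 + d) by rewrite ler_pdivrMr//; nra.
have cdr : (2 - c)^-1 <= (2 - d)^-1 by rewrite lef_pV2 ?posrE//; lra.
have cl0 : 0 <= c / (1 + c) by rewrite divr_ge0//; lra.
have dr1 : (2 - d)^-1 <= 1 by rewrite invf_le1//; lra.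
rewrite {1}/minkowski_measure measureU/=;
  [|exact: measurable_itv|exact: measurable_itv|].
  rewrite -/minkowski_measure !minkowski_measure_itv01//; [|lra|lra].
  rewrite -EFinD !question_mark_div1D// !question_mark_inv2B//.
  by congr EFin; field.
apply/seteqP; split => // x [] /=; rewrite !in_itv/= => /andP[_ ?] /andP[? _].
by lra.
Qed.

End minkowski_invariance.

Theorem mainTheorem3 (R : realType) (B : set (measurableTypeR R)) :
  measurable B -> B `<=` `[0, 1] ->
  transfer_A minkowski_measure B = minkowski_measure B.
Proof.
move=> mB _.
have m01 : measurable (`]0, 1]%classic : set (measurableTypeR R)).
  exact: measurable_itv.
pose mu : {measure set (measurableTypeR R) -> \bar R} :=
  lebesgue_stieltjes_measure question_mark_cdf.
have mAB : measurable (map_A @^-1` B : set (measurableTypeR R)).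
  by rewrite -[X in measurable X]setTI; exact: measurable_map_A.
(* Restricting [mu] to ]0, 1] before pushing forward gives a genuine measure, to which uniqueness
   applies; only the null point 0 is lost. *)
transitivity (pushforward (mrestr mu m01)
    (map_A : measurableTypeR R -> measurableTypeR R) B).
  rewrite /transfer_A /pushforward /mrestr.
  have -> : (`[0, 1] `&` map_A @^-1` B : set (measurableTypeR R)) =
      (map_A @^-1` B `&` `]0, 1]) `|` (map_A @^-1` B `&` [set 0]).
    rewrite -setIUr setIC; congr (_ `&` _).
    apply/seteqP; split => x /=; rewrite !in_itv/=.
      move=> /andP[]; rewrite le_eqVlt => /predU1P[<- _|x0 ->]; first by right.
      by left; rewrite x0.
    by move=> [/andP[/ltW -> ->//]|->]; rewrite lexx ler01.
  have m0 : measurable [set (0 : measurableTypeR R)] by exact: measurable_set1.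
  apply: (@measureU0 _ _ _ mu); [exact: measurableI..|].
  apply: (@subset_measure0 _ _ _ mu _ [set 0]) => //.
  - exact: measurableI.
  - exact: minkowski_measure_set1_0.
apply/esym; apply: lebesgue_stieltjes_measure_unique => //.
- exact: measurable_map_A.
move=> mA _ [[a b] _ <-] /=.
have [ab|ba] := leP a b; last first.
  by rewrite set_itv_ge ?measure0// bnd_simp -leNgt ltW.
(* Uniqueness tests intervals with arbitrary real endpoints. Clipping them to [0, 1] keeps the mass,
   since the distribution function is constant on either side of [0, 1]. *)
pose clip (x : R) := Num.max 0 (Num.min x 1).
have clip01 x : 0 <= clip x <= 1.
  by rewrite le_max lexx ge_max ler01 ge_min lexx orbT.
have clip_le : clip a <= clip b.
  by rewrite ge_max !le_max lexx/= !le_min !ge_min ab lexx ?orbT.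
have /andP[ca0 _] := clip01 a; have /andP[_ cb1] := clip01 b.
transitivity (mu `]clip a, clip b]%classic).
  rewrite [LHS]minkowski_measure_itv// [RHS]minkowski_measure_itv//.
  by rewrite (question_mark_cdfE (clip01 a)) (question_mark_cdfE (clip01 b)).
rewrite -[LHS]minkowski_measure_preimage_itv// /pushforward /mrestr.
(* This would fail at z = 0 when a < 0 <= b, hence the restriction to ]0, 1]. *)
have clipE z : 0 < z <= 1 -> (z \in `]clip a, clip b]) = (z \in `]a, b]).
  move=> /andP[z0 z1]; rewrite !in_itv/= /clip gt_max z0/= gt_min le_max le_min.
  by rewrite z1 andbT [z <= 0]leNgt z0 [1 < z]ltNge z1 orbF.
congr (minkowski_measure _); apply/seteqP.
by split => x /= [+ x01]; rewrite clipE ?map_A_itv.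
Qed.
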